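(* Let $\langle W|$ be a row vector, $|V\rangle$ a column vector, and $D$ and $E$ matrices (not necessarily finite-dimensional) satisfying $$\langle W|V\rangle = 1,\qquad D|V\rangle = E|V\rangle,\qquad \langle W|E=\langle W|,\qquad DE=qED+D.$$ Then for every $n\ge 0$, $$\langle W|D^n|V\rangle = F_n(q):=\sum_{\pi\in S_n} q^{\mathrm{inv}(\pi)} .$$
   Context: $S_n$ is the set of permutations of $\{1,\dots,n\}$. An inversion of $\pi\in S_n$ is a pair $(i,j)$ with $i<j$ and $\pi(i)>\pi(j)$, and $\mathrm{inv}(\pi)$ is the number of inversions of $\pi$. $q$ is a parameter (indeterminate). The vectors and matrices may be infinite; as usual for such relations, all products of them that are considered are assumed to be well defined and associative. *)

(* Defs.v *)
From mathcomp Require Import all_boot all_order all_algebra all_fingroup.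

Set Implicit Arguments.
Unset Strict Implicit.
Unset Printing Implicit Defensive.

Import GRing.Theory.
Local Open Scope ring_scope.

Definition inversions (n : nat) (s : 'S_n) : nat :=
  #|[set p : 'I_n * 'I_n | (p.1 < p.2)%N && (s p.2 < s p.1)%N]|.

Definition inv_gf (R : comNzRingType) (q : R) (n : nat) : R :=
  \sum_(s : 'S_n) q ^+ inversions s.

(* A way of summing families indexed by a possibly infinite type: a partially
   defined linear form extending the finite sums.  Plain finite sums, finitely
   supported sums and convergent series are instances.  Outside [summable],
   [sum_of] takes an irrelevant value. *)
Record summation (R : comNzRingType) (I : eqType) := Summation {
  summable : (I -> R) -> Prop;
  sum_of : (I -> R) -> R;
  sum_finite : forall (r : seq I) (f : I -> R),
    uniq r -> (forall i, i \notin r -> f i = 0) ->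
    summable f /\ sum_of f = \sum_(i <- r) f i;
  sum_linear : forall (a : R) (f g : I -> R),
    summable f -> summable g ->
    summable (fun i => a * f i + g i) /\
    sum_of (fun i => a * f i + g i) = a * sum_of f + sum_of g
}.

(* Row (resp. column) vectors have [unit] as their row (resp. column) type. *)
Definition infmx (R : Type) (I J : Type) := I -> J -> R.

Section Products.

Variables (R : comNzRingType) (I : eqType) (S : summation R I).

Definition infmul_defined (J K : Type) (A : infmx R J I) (B : infmx R I K) : Prop :=
  forall j k, summable S (fun i => A j i * B i k).

Definition infmul (J K : Type) (A : infmx R J I) (B : infmx R I K) : infmx R J K :=
  fun j k => sum_of S (fun i => A j i * B i k).

Definition idmx : infmx R I I := fun i j => (i == j)%:R.

Definition infpow (A : infmx R I I) (n : nat) : infmx R I I :=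
  iter n (infmul A) idmx.

Definition infmul_assoc (J K : Type)
    (A : infmx R J I) (B : infmx R I I) (C : infmx R I K) : Prop :=
  [/\ infmul_defined A B, infmul_defined B C,
      infmul_defined (infmul A B) C, infmul_defined A (infmul B C) &
      infmul (infmul A B) C =2 infmul A (infmul B C)].

(* The monomial in D and E spelled by w: true stands for D, false for E. *)
Definition word (D E : infmx R I I) (w : seq bool) : infmx R I I :=
  foldr (fun b A => infmul (if b then D else E) A) idmx w.

(* Every product of the form [W] X_1 ... X_k [V], with each X_i equal to D or E
   and the factors W and V optional, is defined and has the same value whatever
   its bracketing. *)
Definition products_ok (W : infmx R unit I) (D E : infmx R I I)
    (V : infmx R I unit) : Prop :=
  forall u v w : seq bool,
  let m := word D E in
  [/\ infmul_assoc (m u) (m v) (m w),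
      infmul_assoc (infmul W (m u)) (m v) (m w),
      infmul_assoc (m u) (m v) (infmul (m w) V) &
      infmul_assoc (infmul W (m u)) (m v) (infmul (m w) V)].

End Products.

(* Main.v *)
Require Import Defs.
From mathcomp Require Import all_boot all_order all_algebra all_fingroup.
From Stdlib Require Import FunctionalExtensionality.

(** Both sides are the q-factorial [1][2]...[n], where [k] = 1 + q + ... +
    q^(k-1).

    On the permutation side, a permutation of n+1 points is determined by the
    image j of the first point and by the pattern s of the remaining ones.  The
    first point is in j inversions, the others have those of s, so the
    generating function is multiplied by [n+1] ([inv_gfS]).

    On the matrix side, D^n E = q^n E D^n + [n] D^n follows from DE = qED + D.
    Replacing the last D of <W|D^(n+1)|V> by E, moving it to the left with this
    rule and absorbing it in <W| yields
    <W|D^(n+1)|V> = (q^n + [n]) <W|D^n|V>, which is the same recursion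
    ([bracketS]).

    The matrices being infinite, each rebracketing or expansion of a product
    has to be justified by the hypothesis on products.  All products are
    therefore bracketed to the right, as columns X_1 (X_2 (... (X_k V)))
    ([row_word_col]).  The recursion then only uses the associativity of
    products of two letters, or of W and a letter, with such a column, and the
    linearity of products whose factors are of this kind. *)

Set Implicit Arguments.
Unset Strict Implicit.
Unset Printing Implicit Defensive.

Import GRing.Theory.
Local Open Scope ring_scope.

(** * The inversion generating function *)

Lemma inversions_sum n (s : 'S_n) :
  inversions s =
  (\sum_(i < n) \sum_(j < n) ((i < j) && (s j < s i)))%N.
Proof.
rewrite /inversions -sum1_card big_mkcond pair_big /=.
by apply: eq_bigr => p _; rewrite inE; case: (_ && _).
Qed.

(** The first point is inverted with the points whose images are the j values
    below its own image j; the other inversions are those of s, since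
    [lift ord0] and [lift j] are increasing. *)
Lemma inversions_lift_perm n (j : 'I_n.+1) (s : 'S_n) :
  inversions (lift_perm ord0 j s) = (j + inversions s)%N.
Proof.
have bump_ltn (k : nat) : (bump j k < j)%N = (k < j)%N.
  by rewrite /bump; case: (leqP j k) => h; [rewrite ltnNge leqW | ].
have bump_mono (k l : nat) : (bump j k < bump j l)%N = (k < l)%N.
  by rewrite !ltnNge leq_bump2.
rewrite !inversions_sum big_ord_recl big_ord_recl /= add0n; congr (_ + _)%N.
- under eq_bigr => k _ do rewrite lift_perm_id lift_perm_lift /= bump_ltn.
  (* Reindexing by s^-1 leaves the number of k < n with k < j. *)
  rewrite (reindex_inj (@perm_inj _ s^-1%g)) /=.
  under eq_bigr => k _ do rewrite permKV.
  transitivity (\sum_(k < n | (k < j)%N) 1)%N.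
    by rewrite [RHS]big_mkcond; apply: eq_bigr => k _; case: (_ < _)%N.
  have le_jn : (j <= n)%N by rewrite -ltnS ltn_ord.
  by rewrite -(big_ord_widen _ (fun=> 1%N) le_jn) sum1_card card_ord.
- apply: eq_bigr => k _; rewrite big_ord_recl /= add0n.
  by apply: eq_bigr => l _; rewrite !lift_perm_lift /= bump_mono.
Qed.

(** Injectivity suffices, both sides having (n+1)! elements. *)
Lemma lift_perm0_bij n :
  bijective (fun p : 'I_n.+1 * 'S_n => lift_perm ord0 p.1 p.2).
Proof.
apply: inj_card_bij => [[j s] [k t] /= eq_st|]; last first.
  by rewrite card_prod !card_Sn card_ord factS.
have eq_jk : j = k.
  by rewrite -(lift_perm_id ord0 j s) eq_st lift_perm_id.
rewrite -{}eq_jk in eq_st *; congr (_, _); apply/permP=> i.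
by apply: (@lift_inj _ j); rewrite -!(lift_perm_lift ord0) eq_st.
Qed.

Lemma inv_gf0 (R : comNzRingType) (q : R) : inv_gf q 0 = 1.
Proof.
rewrite /inv_gf (big_pred1 1%g) => [|s]; last first.
  by apply/esym/eqP/permP => -[].
by rewrite inversions_sum big_ord0.
Qed.

Lemma inv_gfS (R : comNzRingType) (q : R) n :
  inv_gf q n.+1 = (\sum_(i < n.+1) q ^+ i) * inv_gf q n.
Proof.
rewrite /inv_gf (reindex _ (onW_bij _ (lift_perm0_bij n))) mulr_suml.
under [RHS]eq_bigr => j _ do rewrite mulr_sumr.
rewrite pair_big; apply: eq_bigr => -[j s] _ /=.
by rewrite inversions_lift_perm exprD.
Qed.

(** * Products over a summation *)

(** A summation need not a priori respect pointwise equality of families, so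
    pointwise equal matrices have to be identified before they are rewritten
    inside a product. *)
Lemma funext2 (A B C : Type) (f g : A -> B -> C) : f =2 g -> f = g.
Proof.
by move=> eq_fg; do 2!apply: functional_extensionality => ?; apply: eq_fg.
Qed.

Section InfMul.

Variables (R : comNzRingType) (I : eqType) (S : summation R I).

Definition lincomb (J K : Type) (a b : R) (A B : infmx R J K) : infmx R J K :=
  fun j k => a * A j k + b * B j k.

(** The linearity axiom puts a coefficient on one family only; the other one
    gets its coefficient from a first combination with the null family. *)
Lemma sum_lincomb (a b : R) (f g : I -> R) :
  summable S f -> summable S g ->
  sum_of S (fun i => a * f i + b * g i) = a * sum_of S f + b * sum_of S g.
Proof.
move=> sf sg.
have [|s0 sum0] := @sum_finite _ _ S [::] (fun=> 0) isT; first by [].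
have [] := sum_linear b sg s0.
rewrite sum0 big_nil addr0 (_ : (fun i => _) = fun i => b * g i).
  by move=> sbg <-; rewrite -(sum_linear a sf sbg).2.
by apply: functional_extensionality => i; rewrite addr0.
Qed.

Lemma infmul_idr (J : Type) (A : infmx R J I) :
  infmul S A (@idmx R I) = A.
Proof.
apply: funext2 => j k; rewrite /infmul.
have [//|i ik|_ ->] := @sum_finite _ _ S [:: k] (fun i => A j i * idmx R i k).
  by move: ik; rewrite inE /idmx => /negPf->; rewrite mulr0.
by rewrite big_seq1 /idmx eqxx mulr1.
Qed.

Lemma infmul_idl (K : Type) (B : infmx R I K) :
  infmul S (@idmx R I) B = B.
Proof.
apply: funext2 => j k; rewrite /infmul.
have [//|i ij|_ ->] := @sum_finite _ _ S [:: j] (fun i => idmx R j i * B i k).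
  by move: ij; rewrite inE /idmx eq_sym => /negPf->; rewrite mul0r.
by rewrite big_seq1 /idmx eqxx mul1r.
Qed.

Lemma infmul_lincombr (J K : Type) (a b : R) (A : infmx R J I)
    (B C : infmx R I K) :
  infmul_defined S A B -> infmul_defined S A C ->
  infmul S A (lincomb a b B C) = lincomb a b (infmul S A B) (infmul S A C).
Proof.
move=> dB dC; apply: funext2 => j k.
rewrite /lincomb /infmul -(sum_lincomb a b (dB j k) (dC j k)); congr sum_of.
by apply: functional_extensionality => i; rewrite mulrDr !(mulrCA (A j i)).
Qed.

Lemma infmul_lincombl (J K : Type) (a b : R) (A B : infmx R J I)
    (C : infmx R I K) :
  infmul_defined S A C -> infmul_defined S B C ->
  infmul S (lincomb a b A B) C = lincomb a b (infmul S A C) (infmul S B C).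
Proof.
move=> dA dB; apply: funext2 => j k.
rewrite /lincomb /infmul -(sum_lincomb a b (dA j k) (dB j k)); congr sum_of.
by apply: functional_extensionality => i; rewrite mulrDl !mulrA.
Qed.

End InfMul.

(** * The matrix algebra *)

Section MatrixAlgebra.

Variables (R : comNzRingType) (q : R) (I : eqType) (S : summation R I).
Variables (W : infmx R unit I) (V : infmx R I unit) (D E : infmx R I I).

Local Notation "A ** B" := (infmul S A B) (at level 40, left associativity).

Hypothesis hprod : products_ok S W D E V.

Let letter (b : bool) : infmx R I I := if b then D else E.

(** The column X_1 (X_2 (... (X_k V))) of the word w = X_1 ... X_k. *)
Definition col (w : seq bool) : infmx R I unit :=
  foldr (fun b X => letter b ** X) V w.

Let word1 b : word S D E [:: b] = letter b.
Proof. exact: infmul_idr. Qed.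

(** By associativity of X, w and V, the first letter X of a word can be
    detached from the product with V. *)
Lemma word_col w : word S D E w ** V = col w.
Proof.
elim: w => [|b w IHw] /=; first exact: infmul_idl.
have [_ _ + _] := hprod [:: b] w [::].
rewrite word1 [word _ _ _ [::] ** V]infmul_idl => -[_ _ _ _ /funext2 eq_bw].
by rewrite -IHw -eq_bw.
Qed.

Lemma letter_col_assoc b c w :
  infmul_assoc S (letter b) (letter c) (col w).
Proof.
by have [_ _ + _] := hprod [:: b] [:: c] w; rewrite !word1 word_col.
Qed.

Lemma row_letter_assoc b w : infmul_assoc S W (letter b) (col w).
Proof.
have [_ _ _] := hprod [::] [:: b] w.
by rewrite word1 word_col infmul_idr.
Qed.

Lemma letter_col_defined b w : infmul_defined S (letter b) (col w).
Proof. by have [_] := letter_col_assoc b b w. Qed.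

Lemma row_col_defined w : infmul_defined S W (col w).
Proof.
have [_ _ _ [_ _ + _ _]] := hprod [::] [::] w.
by rewrite word_col !infmul_idr.
Qed.

Lemma row_word_col w : W ** word S D E w ** V = W ** col w.
Proof.
have [_ _ _] := hprod [::] w [::].
rewrite infmul_idr infmul_idl.
by case=> _ _ _ _ /funext2 ->; rewrite word_col.
Qed.

Lemma infpow_word n : infpow S D n = word S D E (nseq n true).
Proof. by elim: n => //= n ->. Qed.

Hypothesis hDV : D ** V = E ** V.
Hypothesis hWE : W ** E = W.
Hypothesis hDE : D ** E = lincomb q 1 (E ** D) D.

Lemma row_col_E w : W ** col (false :: w) = W ** col w.
Proof.
by have [_ _ _ _ /funext2 /= <-] := row_letter_assoc false w; rewrite /= hWE.
Qed.

(** The last letter acts on V, where D and E agree. *)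
Lemma col_rcons w : col (rcons w true) = col (rcons w false).
Proof. by elim: w => //= b w ->. Qed.

Lemma col_DE w :
  col [:: true, false & w] =
  lincomb q 1 (col [:: false, true & w]) (col (true :: w)).
Proof.
have [_ _ _ _ /funext2 assocDE] := letter_col_assoc true false w.
have [_ _ defED _ /funext2 assocED] := letter_col_assoc false true w.
rewrite /= -assocDE /= hDE infmul_lincombl ?assocED //.
exact: (letter_col_defined true).
Qed.

(** This is D^n E = q^n E D^n + [n] D^n, applied to the column of w.  In the
    inductive step D is multiplied on the left: D (E D^n) = q E D^(n+1) + D^(n+1)
    contributes the summand q^n of [n+1] = [n] + q^n. *)
Lemma col_DnE n w :
  col (nseq n true ++ false :: w) =
  lincomb (q ^+ n) (\sum_(i < n) q ^+ i)
    (col (false :: nseq n true ++ w)) (col (nseq n true ++ w)).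
Proof.
elim: n => [|n IHn].
  by apply: funext2 => i j; rewrite /lincomb big_ord0 mul0r addr0 expr0 mul1r.
rewrite [LHS]/= IHn infmul_lincombr; try exact: (letter_col_defined true).
rewrite [infmul S _ (col (false :: _))]col_DE.
apply: funext2 => i j; rewrite /lincomb big_ord_recr /= exprSr.
by rewrite mulrDr mul1r mulrA mulrDl addrAC addrA.
Qed.

(** Trading the last D for an E and moving it to W gives q^n + [n] = [n+1]. *)
Lemma bracketS n :
  (W ** col (nseq n.+1 true)) tt tt =
  (\sum_(i < n.+1) q ^+ i) * (W ** col (nseq n true)) tt tt.
Proof.
rewrite -addn1 nseqD cats1 col_rcons -cats1 col_DnE cats0.
rewrite infmul_lincombr; try exact: row_col_defined.
by rewrite row_col_E /lincomb -mulrDl addrC addn1 big_ord_recr.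
Qed.

End MatrixAlgebra.

Theorem proposition1 (R : comNzRingType) (q : R) (I : eqType)
    (S : summation R I) (W : infmx R unit I) (V : infmx R I unit)
    (D E : infmx R I I)
    (hprod : products_ok S W D E V)
    (hWV : infmul S W V tt tt = 1)
    (hDV : infmul S D V =2 infmul S E V)
    (hWE : infmul S W E =2 W)
    (hDE : infmul S D E =2 (fun i j => q * infmul S E D i j + D i j))
    (n : nat) :
  infmul S (infmul S W (infpow S D n)) V tt tt = inv_gf q n.
Proof.
have DE_comb : infmul S D E = lincomb q 1 (infmul S E D) D.
  by apply: funext2 => i j; rewrite hDE /lincomb mul1r.
rewrite (infpow_word S D E) (row_word_col hprod).
elim: n => [|n IHn]; first by rewrite inv_gf0.
rewrite inv_gfS -IHn.
exact: (bracketS hprod (funext2 hDV) (funext2 hWE) DE_comb).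
Qed.
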